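(* Let $A_1=P_1J_1P_1^{-1}$ with $J_1=\mathrm{diag}(-p_1,-q_1)$, $0<p_1<q_1$, and $A_2=P_2J_2P_2^{-1}$ with $J_2=\mathrm{diag}(p_2,q_2)$, where either $0<p_2<q_2$ or $p_2\le 0<q_2$; here $P_1,P_2$ are real invertible $2\times 2$ matrices chosen such that $M=P_2^{-1}P_1=\begin{pmatrix}a&b\\c&d\end{pmatrix}$ has determinant $1$. Suppose all entries of $M$ are nonzero and $\frac{abcd}{|abcd|}=-1$. Given $\eta>0$, let $\tau_{1,2}(\eta)$ be the unique solution $t>\max\left(\frac{p_2}{p_1},\frac{q_2}{q_1}\right)\eta$ of $$-\frac{\left(e^{q_2\eta-p_1t}-1\right)\left(e^{p_2\eta-q_1t}-1\right)}{\left(e^{-p_1t}-e^{-q_1t}\right)\left(e^{q_2\eta}-e^{p_2\eta}\right)}=ad.$$ Then the switched system $\dot x(t)=A_{\sigma(t)}x(t)$ is stable for all signals $\sigma\in\mathcal S[\tau_{1,2}(\eta),\eta]$ and asymptotically stable for all signals $\sigma\in\mathcal S'[\tau_{1,2}(\eta),\eta]$.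
   Context: Planar switched system: $\dot x(t)=A_{\sigma(t)}x(t)$, $x(t)\in\mathbb R^2$ continuous in $t\ge0$, with $A_1,A_2$ real $2\times2$ matrices. A switching signal $\sigma:[0,\infty)\to\{1,2\}$ is right-continuous and piecewise constant with infinitely many discontinuities $0<d_1<d_2<\cdots$, $d_k\to\infty$; set $d_0=0$. For a signal with $\sigma(0)=1$ put $t_k=d_{2k-1}-d_{2k-2}$ (times spent in $A_1$) and $s_k=d_{2k}-d_{2k-1}$ (times spent in $A_2$), $k\ge1$. For $\tau,\eta>0$, $\mathcal S[\tau,\eta]$ is the set of signals with $\sigma(0)=1$, $t_k\ge\tau$ and $s_k\le\eta$ for all $k\in\mathbb N$; $\mathcal S'[\tau,\eta]$ is the set of $\sigma\in\mathcal S[\tau,\eta]$ for which the sequence $(t_k,s_k)_{k\ge1}$ does not converge to $(\tau,\eta)$. For a given signal $\sigma$, the system is stable if for every $\varepsilon'>0$ there is $\delta>0$ such that $\|x(0)\|<\delta$ implies $\|x(t)\|<\varepsilon'$ for all $t>0$; it is asymptotically stable if it is stable and $\|x(t)\|\to0$ as $t\to\infty$ for every $x(0)\in\mathbb R^2$. Norms are Euclidean. *)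

(* Defs.v *)
From mathcomp Require Import all_boot all_order all_algebra.
From mathcomp Require Import all_classical all_reals all_analysis.
Set Implicit Arguments.
Unset Strict Implicit.
Unset Printing Implicit Defensive.
Import Order.TTheory GRing.Theory Num.Theory.
Import numFieldNormedType.Exports.
Local Open Scope classical_set_scope.
Local Open Scope ring_scope.

Definition diag2 (R : realType) (x y : R) : 'M[R]_2 :=
  diag_mx (\row_j [:: x; y]`_j).

Definition mx2 (R : realType) (a b c d : R) : 'M[R]_2 :=
  \matrix_(i, j) (nth [::] [:: [:: a; b]; [:: c; d]] i)`_j.

(* The library norm on matrices is the sup norm, hence this definition. *)
Definition enorm (R : realType) (v : 'cV[R]_2) : R :=
  Num.sqrt (\sum_i v i 0 ^+ 2).

Inductive mode := Mode1 | Mode2.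

(* Only the values of [sig_fun] on [0, +oo[ matter.  Right-continuity is the
   constancy on the left-closed intervals [d_k, d_(k+1)[, and [sig_switch] makes
   d_1 < d_2 < ... exactly the discontinuities on ]0, +oo[. *)
Record signal (R : realType) := Signal {
  sig_fun :> R -> mode ;
  sig_time : nat -> R ;
  sig_time0 : sig_time 0 = 0 ;
  sig_time_lt : forall k, sig_time k < sig_time k.+1 ;
  sig_time_cvg : sig_time @ \oo --> +oo ;
  sig_const : forall k t, sig_time k <= t < sig_time k.+1 ->
    sig_fun t = sig_fun (sig_time k) ;
  sig_switch : forall k, sig_fun (sig_time k.+1) <> sig_fun (sig_time k) }.

(* Indices are shifted by one: [dwell1 s k] is t_(k+1), [dwell2 s k] is s_(k+1);
   this reading assumes sigma(0) = 1. *)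
Definition dwell1 (R : realType) (s : signal R) (k : nat) : R :=
  sig_time s k.*2.+1 - sig_time s k.*2.

Definition dwell2 (R : realType) (s : signal R) (k : nat) : R :=
  sig_time s k.*2.+2 - sig_time s k.*2.+1.

Definition signals (R : realType) (tau eta : R) : set (signal R) :=
  [set s : signal R | s 0 = Mode1 /\
           forall k, tau <= dwell1 s k /\ dwell2 s k <= eta].

Definition signals' (R : realType) (tau eta : R) : set (signal R) :=
  [set s : signal R | signals tau eta s /\
           ~ ((dwell1 s k, dwell2 s k) @[k --> \oo] --> (tau, eta))].

Definition mode_mx (R : realType) (A1 A2 : 'M[R]_2) (m : mode) : 'M[R]_2 :=
  match m with Mode1 => A1 | Mode2 => A2 end.

(* The differential equation is required away from the switching times, where a
   continuous solution is in general not differentiable.  As d_0 = 0, the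
   initial time is excluded too: x is unconstrained on the negative reals. *)
Definition is_solution (R : realType) (A1 A2 : 'M[R]_2) (s : signal R)
    (x : R -> 'cV[R]_2) : Prop :=
  {within `[0, +oo[, continuous x} /\
  forall t : R, 0 <= t -> (forall k, t != sig_time s k) ->
    is_derive t 1 x (mode_mx A1 A2 (s t) *m x t).

Definition stable (R : realType) (A1 A2 : 'M[R]_2) (s : signal R) : Prop :=
  forall e : R, 0 < e -> exists2 delta : R, 0 < delta &
    forall x, is_solution A1 A2 s x -> enorm (x 0) < delta ->
      forall t : R, 0 < t -> enorm (x t) < e.

Definition asymptotically_stable (R : realType) (A1 A2 : 'M[R]_2)
    (s : signal R) : Prop :=
  stable A1 A2 s /\
  forall x, is_solution A1 A2 s x -> enorm (x t) @[t --> +oo] --> (0 : R).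

(* Main.v *)
Require Import Defs.
From mathcomp Require Import all_boot all_order all_algebra.
From mathcomp Require Import all_classical all_reals all_analysis.
From mathcomp Require Import ring lra.
Set Implicit Arguments.
Unset Strict Implicit.
Unset Printing Implicit Defensive.
Import Order.TTheory GRing.Theory Num.Theory.
Import numFieldNormedType.Exports.
Local Open Scope classical_set_scope.
Local Open Scope ring_scope.

(**
Write [E = exp (p2 eta)], [F = exp (q2 eta)], [X = exp (p1 tau)],
[Y = exp (q1 tau)], let [u = P1^-1 x] and [w = P2^-1 x = M u].  From [det M = 1]
and [abcd < 0] one gets [0 < ad < 1], and then a diagonal change of scale in [u]
and another one in [w] make [M] a rotation ([symmetrizer]).  Both modes are thus
given by symmetric matrices in one and the same Euclidean structure.  Let
[S s = M^-1 diag(exp (p2 s), exp (q2 s)) M] be the flow of the second mode and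
[K = diag(1/X, 1/Y)] that of the first mode during the time [tau].

After division by a nonzero factor, the equation that defines [tau] reads
[det (K^-1 - S eta) = 0] ([threshold_eqE]).  On the half-line where it is to be
solved, [Y] exceeds the second diagonal entry of [S eta], so that the equation
says that [K^-1 - S eta] is singular and positive semidefinite.  Both diagonal
entries increase with [tau], hence uniqueness, and the determinant changes sign
between the left end of the half-line and [q2 eta / p1], hence existence
([threshold_exists_unique]).

The Lyapunov function is the form [<u, K u>].  For fixed [y], [<S s y, y>] is a
combination of [exp (p2 s)] and [exp (q2 s)] with nonnegative coefficients,
hence convex in [s]; whatever the sign of [p2], it lies below its chord on
[[0, eta]], where [S 0 = 1 <= K^-1 / X] and [S eta <= K^-1].  So
[<S s K u, K u> <= rho <u, K u>] with [rho = (1 - s/eta) / X + s/eta <= 1], and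
Cauchy-Schwarz for [S s] turns this into a contraction by [rho^2] of the
Lyapunov function ([symmetric_contraction]).  The time spent in the first mode
beyond [tau] contributes a further factor [exp (- 2 p1 (t - tau))].

The Lyapunov function is therefore, during a whole period, at most its value at
the beginning, which gives stability.  Over the k-th period it is multiplied by
at most a rate [f k <= 1].  If its values at the beginnings of the periods did
not tend to 0, these rates would tend to 1, which forces [(t_k, s_k)] to tend to
[(tau, eta)] ([period_rate_cvg1]); this is what the smaller class of signals
excludes.
*)

(** * Vectors and matrices of size two *)

Lemma mulmxE2 (R : realType) (B : 'M[R]_2) (v : 'cV[R]_2) i :
  (B *m v) i 0 = B i 0 * v 0 0 + B i 1 * v 1 0.
Proof.
rewrite mxE !big_ord_recl big_ord0 addr0.
by congr (_ + B i _ * v _ 0); apply/val_inj.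
Qed.

Lemma det_mx2 (R : realType) (a b c d : R) :
  \det (mx2 a b c d) = a * d - b * c.
Proof.
rewrite (expand_det_row _ 0) !big_ord_recl big_ord0 addr0 /cofactor.
by rewrite !det_mx11 !mxE /= expr0 mul1r expr1 mulN1r mulrN.
Qed.

Lemma lt0_of_div_normr (R : realType) (y : R) : y != 0 -> y / `|y| = -1 -> y < 0.
Proof.
move=> y0; have ny : 0 < `|y| by rewrite normr_gt0.
by move=> /(canRL (mulfVK (lt0r_neq0 ny))) ->; rewrite mulN1r oppr_lt0.
Qed.

Lemma enorm_sqr (R : realType) (v : 'cV[R]_2) :
  enorm v ^+ 2 = v 0 0 ^+ 2 + v 1 0 ^+ 2.
Proof.
rewrite /enorm sqr_sqrtr; last by apply: sumr_ge0 => i _; exact: sqr_ge0.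
rewrite !big_ord_recl big_ord0 addr0.
by congr (_ + v _ 0 ^+ 2); apply/val_inj.
Qed.

Lemma enorm_ge0 (R : realType) (v : 'cV[R]_2) : 0 <= enorm v.
Proof. exact: sqrtr_ge0. Qed.

Lemma enorm_mulmx_le (R : realType) (B : 'M[R]_2) :
  exists2 K : R, 0 < K & forall v, enorm (B *m v) ^+ 2 <= K * enorm v ^+ 2.
Proof.
exists (1 + (B 0 0 ^+ 2 + B 0 1 ^+ 2 + B 1 0 ^+ 2 + B 1 1 ^+ 2)).
  by rewrite ltr_wpDr // !addr_ge0 // sqr_ge0.
move=> v; rewrite !enorm_sqr !mulmxE2 -subr_ge0.
set v0 := v 0 0; set v1 := v 1 0.
have -> : (1 + (B 0 0 ^+ 2 + B 0 1 ^+ 2 + B 1 0 ^+ 2 + B 1 1 ^+ 2)) *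
  (v0 ^+ 2 + v1 ^+ 2) - ((B 0 0 * v0 + B 0 1 * v1) ^+ 2 +
  (B 1 0 * v0 + B 1 1 * v1) ^+ 2) = v0 ^+ 2 + v1 ^+ 2 +
  (B 0 0 * v1 - B 0 1 * v0) ^+ 2 + (B 1 0 * v1 - B 1 1 * v0) ^+ 2 by ring.
by rewrite !addr_ge0 // sqr_ge0.
Qed.

(** * The flow of a diagonalizable mode *)

Lemma is_derive_mulmx (R : realType) (B : 'M[R]_2) (x : R -> 'cV[R]_2)
    (dx : 'cV[R]_2) (t : R) i :
  is_derive t 1 x dx -> is_derive t 1 (fun s => (B *m x s) i 0) ((B *m dx) i 0).
Proof.
move=> [dxt <-]; have xk k : is_derive t 1 (fun s => x s k 0) ('D_1 x t k 0).
  by split; [have /derivable_mxP := dxt; exact | rewrite (derive_mx dxt) mxE].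
rewrite mulmxE2 (_ : (fun s => _) =
    B i 0 \*: (fun s => x s 0 0) + B i 1 \*: (fun s => x s 1 0)).
  exact: is_deriveD.
by apply/funext => s; rewrite mulmxE2.
Qed.

Lemma within_continuous_mulmx (R : realType) (B : 'M[R]_2) (x : R -> 'cV[R]_2)
    (I : set R) i :
  {within I, continuous x} -> {within I, continuous (fun s => (B *m x s) i 0)}.
Proof.
move=> cx t.
rewrite (_ : (fun s => _) = (fun v : 'cV[R]_2 => (B *m v) i 0) \o x) //.
apply: (@continuous_comp (subspace I) _ _ x); first exact: cx.
rewrite (_ : (fun v => _) =
    (fun v : 'cV[R]_2 => B i 0 * v 0 0 + B i 1 * v 1 0)).
  have c k : continuous (fun v : 'cV[R]_2 => B i k * v k 0).
    move=> v; apply: (@continuous_comp _ _ _ (fun v : 'cV[R]_2 => v k 0)).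
      exact: coord_continuous.
    exact: mulrl_continuous.
  exact: cvgD (c 0 _) (c 1 _).
by apply/funext => v; rewrite mulmxE2.
Qed.

(** The derivative is only assumed inside the interval, since a solution of the
switched system has in general corners at both ends. *)
Lemma linear_ode_sol (R : realType) (l t0 t1 : R) (f : R -> R) :
  {within `[t0, t1], continuous f} ->
  (forall t, t0 < t < t1 -> is_derive t 1 f (l * f t)) ->
  forall t, t0 <= t <= t1 -> f t = expR (l * (t - t0)) * f t0.
Proof.
move=> cf df t /andP[]; rewrite le_eqVlt => /predU1P[<- _|tt0 tt1].
  by rewrite subrr mulr0 expR0 mul1r.
(* g is constant, which the mean value theorem on [t0, t] gives at t0 and t. *)
pose g s := expR (- l * s) * f s.
have [s st||c _] := @MVT _ g (fun=> 0) t0 t tt0.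
- have {}st : t0 < s < t1.
    by move: st; rewrite in_itv /= => /andP[-> /lt_le_trans ->].
  have ds := df _ st.
  have de : is_derive s 1 (fun s => expR (- l * s)) (- l * expR (- l * s)).
    have dl : is_derive s 1 (fun s => - l * s) (- l).
      by have := is_deriveZ (- l) (is_derive_id s (1 : R)); rewrite scaler1.
    by have := is_derive1_comp (is_derive_expR (- l * s)) dl; rewrite mulrC.
  by apply: is_derive_eq (is_deriveM de ds) _; rewrite /GRing.scale /=; ring.
- have ce : {within `[t0, t], continuous (fun s => expR (- l * s))}.
    apply: continuous_subspaceT => r.
    apply: continuous_comp; last exact: continuous_expR.
    exact: mulrl_continuous.
  have cf' : {within `[t0, t], continuous f}.
    apply: continuous_subspaceW cf => r /=; rewrite !in_itv /=.
    by move=> /andP[-> /le_trans ->].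
  by move=> s; exact: cvgM (ce s) (cf' s).
rewrite mul0r => /eqP; rewrite subr_eq0 /g => /eqP E.
have -> : f t = expR (l * t) * (expR (- l * t) * f t).
  by rewrite mulrA -expRD mulNr subrr expR0 mul1r.
by rewrite E mulrA -expRD mulrBr mulNr.
Qed.

(** In eigencoordinates a mode decouples into two scalar equations. *)
Lemma mode_sol (R : realType) (P : 'M[R]_2) (l1 l2 t0 t1 : R)
    (x : R -> 'cV[R]_2) :
  P \in unitmx -> {within `[t0, t1], continuous x} ->
  (forall t, t0 < t < t1 ->
     is_derive t 1 x (P *m diag2 l1 l2 *m invmx P *m x t)) ->
  forall t, t0 <= t <= t1 ->
    (invmx P *m x t) 0 0 = expR (l1 * (t - t0)) * (invmx P *m x t0) 0 0 /\
    (invmx P *m x t) 1 0 = expR (l2 * (t - t0)) * (invmx P *m x t0) 1 0.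
Proof.
move=> uP cx dx t tt.
have dP s : invmx P *m (P *m diag2 l1 l2 *m invmx P *m x s) =
    diag2 l1 l2 *m (invmx P *m x s) by rewrite !mulmxA mulVmx // mul1mx.
have sol i : (invmx P *m x t) i 0 =
    expR ([:: l1; l2]`_i * (t - t0)) * (invmx P *m x t0) i 0.
  apply: (@linear_ode_sol _ _ t0 t1 (fun s => (invmx P *m x s) i 0)) => //.
    exact: (@within_continuous_mulmx _ (invmx P) x _ i cx).
  move=> s st; have := is_derive_mulmx (invmx P) i (dx _ st).
  by rewrite dP // /diag2 mul_diag_mx !mxE.
by split; [rewrite (sol 0) | rewrite (sol 1)].
Qed.

(** * Switching times *)

Section signal_facts.
Context {R : realType} (s : signal R).

Lemma sig_time_mono : {mono sig_time s : i j / (i <= j)%N >-> i <= j}.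
Proof. exact/le_mono/(homo_ltn lt_trans)/sig_time_lt. Qed.

Lemma sig_time_ge0 k : 0 <= sig_time s k.
Proof. by rewrite -(sig_time0 s) sig_time_mono. Qed.

(** There are only two modes, so that a change of mode at every switching time
is an alternation. *)
Lemma sig_mode k : s 0 = Mode1 ->
  s (sig_time s k) = if odd k then Mode2 else Mode1.
Proof.
move=> s0; elim: k => [|k IH]; first by rewrite sig_time0.
have := @sig_switch _ s k; rewrite IH /=.
by case: (odd k); case: (s _).
Qed.

Lemma sig_period t : 0 <= t ->
  exists k, sig_time s k.*2 <= t <= sig_time s k.*2.+2.
Proof.
move=> t0; have /cvgryPge/(_ t)[N _ hN] := @sig_time_cvg _ s.
have ex : exists n, t <= sig_time s n.*2.+2.
  by exists N; apply: hN => /=; rewrite -addnn -addnS -addnS leq_addr.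
(* The first period that ends at t or later begins before t. *)
exists (ex_minn ex); case: ex_minnP => -[|k] -> min.
  by rewrite sig_time0 t0.
rewrite andbT leNgt; apply/negP => /ltW /min.
by rewrite ltnn.
Qed.

Lemma sig_time_neq k t : sig_time s k < t < sig_time s k.+1 ->
  forall j, t != sig_time s j.
Proof.
move=> /andP[kt tk] j; apply/negP => /eqP tj; move: kt tk.
have lt_mono : {mono sig_time s : i j / (i < j)%N >-> i < j}.
  exact: leW_mono sig_time_mono.
by rewrite tj !lt_mono ltnS => kj; rewrite leqNgt kj.
Qed.

Lemma dwell2_gt0 k : 0 < dwell2 s k.
Proof. by rewrite subr_gt0 sig_time_lt. Qed.

End signal_facts.

Lemma solution_within (R : realType) (A1 A2 : 'M[R]_2) (s : signal R)
    (x : R -> 'cV[R]_2) k :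
  is_solution A1 A2 s x ->
  {within `[sig_time s k, sig_time s k.+1], continuous x} /\
  forall t, sig_time s k < t < sig_time s k.+1 ->
    is_derive t 1 x (mode_mx A1 A2 (s (sig_time s k)) *m x t).
Proof.
move=> [cx dx]; split.
  apply: continuous_subspaceW cx => t /=; rewrite !in_itv /= andbT => /andP[kt _].
  exact: le_trans (sig_time_ge0 s k) kt.
move=> t ktk; have /andP[kt tk] := ktk.
rewrite -(@sig_const _ s k t) ?(ltW kt) //.
apply: dx; last exact: sig_time_neq ktk.
exact: le_trans (sig_time_ge0 s k) (ltW kt).
Qed.

(** * Symmetrization and the threshold dwell time *)

(** With [M = mx2 a b c d] of determinant 1 this says that [diag(n1, n2) M] is
the inverse transpose of [M] times [diag(m, 1)], or
[M^T diag(n1, n2) M = diag(m, 1)]: after scaling the coordinates by square roots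
of the weights, [M] is orthogonal. *)
Definition symmetrizing (R : realFieldType) (a b c d m n1 n2 : R) : Prop :=
  [/\ 0 < m, 0 < n1, 0 < n2 &
    [/\ n1 * a = m * d, n2 * c = - (m * b), n1 * b = - c & n2 * d = a]].

(** The entries of [diag(m, 1)] and [diag(n1, n2)] can be read off from
[n1 b = - c], [n2 d = a] and [m = n1 n2]; they are positive because [bc < 0] and
[ad > 0]. *)
Lemma symmetrizer (R : realFieldType) (a b c d : R) :
  a * d - b * c = 1 -> a * b * c * d < 0 ->
  0 < a * d < 1 /\
  exists m n1 n2 : R, symmetrizing a b c d m n1 n2.
Proof.
move=> det1 neg.
have nz : [/\ a != 0, b != 0, c != 0 & d != 0].
  by split; apply: contraTneq neg => ->; rewrite ?(mul0r, mulr0) ltxx.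
have [a0 b0 c0 d0] := nz.
have ad0 : 0 < a * d by nra.
have ad1 : a * d < 1 by nra.
have cb0 : 0 < - (c * b) by nra.
split; first by rewrite ad0.
have b20 : 0 < b ^+ 2 by rewrite exprn_even_gt0.
have d20 : 0 < d ^+ 2 by rewrite exprn_even_gt0.
have n10 : 0 < - (c * b) / b ^+ 2 by rewrite divr_gt0.
have n20 : 0 < a * d / d ^+ 2 by rewrite divr_gt0.
exists (- (c * b) / b ^+ 2 * (a * d / d ^+ 2)), (- (c * b) / b ^+ 2),
  (a * d / d ^+ 2).
split => //; first exact: mulr_gt0.
by split; field; rewrite ?b0 ?d0.
Qed.

(** The determinant of [diag(X, Y) - M^-1 diag(E, F) M] when [det M = 1] and
[al = ad]. *)
Definition det_gap (R : realType) (al E F X Y : R) : R :=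
  (X - (al * E + (1 - al) * F)) * (Y - (al * F + (1 - al) * E)) -
  al * (1 - al) * (F - E) ^+ 2.

(** [F < Y] makes the second diagonal entry positive; at a zero of the
determinant the first one is then positive too, and the determinant strictly
increases from there on. *)
Lemma det_gap0_unique (R : realType) (al E F X Y X' Y' : R) :
  0 < al < 1 -> E < F -> F < Y -> X < X' -> Y < Y' ->
  det_gap al E F X Y = 0 -> det_gap al E F X' Y' = 0 -> False.
Proof.
rewrite /det_gap => /andP[al0 al1] EF FY XX' YY'.
set A := X - _; set B := Y - _; set A' := X' - _; set B' := Y' - _.
have B0 : 0 < B by rewrite /B; nra.
have AA' : A < A' by rewrite /A /A' ltrD2r.
have BB' : B < B' by rewrite /B /B' ltrD2r.
have D0 : 0 < al * (1 - al) * (F - E) ^+ 2.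
  by rewrite !mulr_gt0 ?exprn_gt0 // subr_gt0.
move: D0; set D := al * _ * _ => D0 h h'.
have A0 : 0 < A by rewrite -(pmulr_lgt0 _ B0); lra.
nra.
Qed.

(** Multiplying by [X Y] and by the positive denominator turns the quotient into
the determinant. *)
Lemma threshold_eqE (R : realType) (p1 q1 p2 q2 al eta t : R) :
  p1 < q1 -> p2 < q2 -> 0 < eta -> 0 < t ->
  - ((expR (q2 * eta - p1 * t) - 1) * (expR (p2 * eta - q1 * t) - 1)
     / ((expR (- p1 * t) - expR (- q1 * t))
        * (expR (q2 * eta) - expR (p2 * eta)))) = al <->
  det_gap al (expR (p2 * eta)) (expR (q2 * eta)) (expR (p1 * t)) (expR (q1 * t))
    = 0.
Proof.
move=> pq1 pq2 eta0 t0.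
rewrite !expRB.
have EF : expR (p2 * eta) < expR (q2 * eta) by rewrite ltr_expR ltr_pM2r.
have XY : expR (p1 * t) < expR (q1 * t) by rewrite ltr_expR ltr_pM2r.
have -> : expR (- p1 * t) = (expR (p1 * t))^-1 by rewrite mulNr expRN.
have -> : expR (- q1 * t) = (expR (q1 * t))^-1 by rewrite mulNr expRN.
have := expR_gt0 (p1 * t); have := expR_gt0 (q1 * t).
move: EF XY; rewrite /det_gap.
set E := expR (p2 * _); set F := expR (q2 * _).
set X := expR _; set Y := expR _ => EF XY Y0 X0.
have [nE nX nY nXY] : [/\ F - E != 0, X != 0, Y != 0 & Y - X != 0].
  by split; rewrite ?subr_eq0 ?gt_eqF.
have -> : - ((F * X^-1 - 1) * (E * Y^-1 - 1) / ((X^-1 - Y^-1) * (F - E))) =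
          - ((F - X) * (E - Y)) / ((Y - X) * (F - E)).
  by field; rewrite nE nX nY nXY.
split=> [/(canRL (divfK _))|] h.
  have := h _; rewrite mulf_neq0 // => /(_ isT); lra.
apply/(canLR (mulfK _)); first by rewrite mulf_neq0.
lra.
Qed.

(** The intermediate value theorem is applied to the determinant between the left
end of the half-line and [q2 eta / p1], where it equals
[al (F - E) (Y - F) > 0]. *)
Lemma threshold_exists_unique (R : realType) (p1 q1 p2 q2 al eta : R) :
  0 < p1 -> p1 < q1 -> p2 < q2 -> 0 < q2 -> 0 < al < 1 -> 0 < eta ->
  exists tau : R, unique (fun t : R =>
      Num.max (p2 / p1) (q2 / q1) * eta < t /\
      - ((expR (q2 * eta - p1 * t) - 1) * (expR (p2 * eta - q1 * t) - 1)
         / ((expR (- p1 * t) - expR (- q1 * t))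
            * (expR (q2 * eta) - expR (p2 * eta)))) = al) tau.
Proof.
move=> p10 pq1 pq2 q20 /andP[al0 al1] eta0.
have q10 : 0 < q1 by exact: lt_trans pq1.
set E := expR (p2 * eta); set F := expR (q2 * eta).
have EF : E < F by rewrite ltr_expR ltr_pM2r.
set m := Num.max _ _ * eta.
have m0 : 0 < m by rewrite mulr_gt0 // lt_max (divr_gt0 q20 q10) orbT.
have mE : m = p2 * eta / p1 \/ m = q2 * eta / q1.
  by rewrite /m; case: leP => _; [right|left]; rewrite mulrAC.
have mq : q2 * eta <= q1 * m.
  by rewrite -ler_pdivrMl // mulrA [_ * q2]mulrC ler_pM2r // le_max lexx orbT.
pose g t := det_gap al E F (expR (p1 * t)) (expR (q1 * t)).
(* At the left end m either X = E, where the determinant is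
   - (1 - al) (F - E) (Y - E), or Y = F, where it is
   - (1 - al) (F - E) (F - X). *)
have gm : g m < 0.
  have XY : expR (p1 * m) < expR (q1 * m) by rewrite ltr_expR ltr_pM2r.
  have FY : F <= expR (q1 * m) by rewrite ler_expR.
  rewrite /g /det_gap; case: mE => mE.
    have -> : expR (p1 * m) = E by rewrite mE mulrC divfK ?gt_eqF.
    move: FY; set Y := expR _ => FY.
    have : 0 < (1 - al) * (F - E) * (Y - E).
      by rewrite !mulr_gt0 // subr_gt0 // (lt_le_trans EF).
    by lra.
  have YF : expR (q1 * m) = F by rewrite mE mulrC divfK ?gt_eqF.
  move: XY; rewrite YF; set X := expR _ => XF.
  have : 0 < (1 - al) * (F - E) * (F - X) by rewrite !mulr_gt0 ?subr_gt0.
  by lra.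
(* The right end of the bracket is the point where X = F. *)
pose t1 := q2 * eta / p1.
have t10 : 0 < t1 by rewrite divr_gt0 // mulr_gt0.
have XF : expR (p1 * t1) = F by rewrite /t1 mulrC divfK ?gt_eqF.
have gt1 : 0 < g t1.
  have : expR (p1 * t1) < expR (q1 * t1) by rewrite ltr_expR ltr_pM2r.
  rewrite /g /det_gap XF; set Y := expR _ => FY.
  have : 0 < al * (F - E) * (Y - F) by rewrite !mulr_gt0 ?subr_gt0.
  by lra.
have mt1 : m < t1.
  case: mE => ->; first by rewrite ltr_pM2r ?invr_gt0 // ltr_pM2r.
  by rewrite ltr_pM2l ?mulr_gt0 // ltf_pV2.
have cg : {within `[m, t1], continuous g}.
  apply: continuous_subspaceT => t.
  have ce (k : R) : {for t, continuous (fun s : R => expR (k * s))}.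
    apply: continuous_comp; last exact: continuous_expR.
    exact: mulrl_continuous.
  apply: cvgB; last exact: cvg_cst.
  apply: cvgM; apply: cvgB; try exact: cvg_cst; exact: ce.
have [|t] := @IVT _ g m t1 0 (ltW mt1) cg.
  by rewrite ge_min le_max (ltW gm) (ltW gt1) orbT.
rewrite in_itv /= => /andP[mt _] gt.
have {}mt : m < t.
  by rewrite lt_neqAle mt andbT; apply: contraTneq gm => ->; rewrite gt ltxx.
exists t; split.
  by split => //; apply/threshold_eqE => //; exact: lt_trans mt.
have lem s s' : m < s -> s < s' -> g s = 0 -> g s' = 0 -> False.
  move=> ms ss'; apply: det_gap0_unique;
    rewrite ?al0 ?ltr_expR ?ltr_pM2r ?ltr_pM2l //.
  by rewrite (le_lt_trans mq) // ltr_pM2l.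
move=> t' [mt' /threshold_eqE-/(_ pq1 pq2 eta0 (lt_trans m0 mt'))] gt'.
have [tt'|tt'|//] := ltgtP t t'; first by case: (lem _ _ mt tt').
by case: (lem _ _ mt' tt').
Qed.

(** * Contraction over one period *)

(** A symmetric 2 x 2 matrix with zero determinant and a positive diagonal entry
is positive semidefinite; applied to [diag(X, Y) - M^-1 diag(E, F) M], which is
symmetric for the scalar product [m x1 y1 + x2 y2]. *)
Lemma det_gap0_form_le (R : realType) (a b c d m n1 n2 E F X Y y1 y2 : R) :
  a * d - b * c = 1 -> 0 < a * d < 1 ->
  symmetrizing a b c d m n1 n2 ->
  E < F -> F < Y -> det_gap (a * d) E F X Y = 0 ->
  n1 * E * (a * y1 + b * y2) ^+ 2 + n2 * F * (c * y1 + d * y2) ^+ 2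
    <= m * X * y1 ^+ 2 + Y * y2 ^+ 2.
Proof.
move=> det1 /andP[ad0 ad1] [_ _ _ [n1a n2c n1b n2d]] EF FY; rewrite /det_gap.
have B0 : 0 < Y - (a * d * F + (1 - a * d) * E).
  have -> : Y - (a * d * F + (1 - a * d) * E) = (Y - F) + (1 - a * d) * (F - E).
    by ring.
  by rewrite addr_gt0 ?mulr_gt0 ?subr_gt0.
have bc : 1 - a * d = - (b * c) by lra.
move: B0; rewrite bc; set A := X - _; set B := Y - _ => B0 /eqP.
rewrite subr_eq0 => /eqP AB.
(* After multiplication by B the difference of the two sides is a square,
   because its discriminant is proportional to the vanishing determinant. *)
rewrite -subr_ge0 -(pmulr_rge0 _ B0).
set D := (X in _ <= X).
suff -> : D = (a * c * (F - E) * y1 - B * y2) ^+ 2 by exact: sqr_ge0.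
have -> : D = m * (A * B) * y1 ^+ 2 + B ^+ 2 * y2 ^+ 2
              - 2 * (a * c * (F - E)) * B * y1 * y2.
  have XE : X = A + (a * d * E - b * c * F) by rewrite /A; ring.
  have YE : Y = B + (a * d * F - b * c * E) by rewrite /B; ring.
  have q1 : n1 * a * a = m * d * a by rewrite n1a.
  have q2 : n1 * a * b = - (a * c) by rewrite mulrAC n1b; ring.
  have q3 : n1 * b * b = - (b * c) by rewrite n1b; ring.
  have q4 : n2 * c * c = - (m * b * c) by rewrite n2c; ring.
  have q5 : n2 * d * c = a * c by rewrite n2d.
  have q6 : n2 * d * d = a * d by rewrite n2d.
  rewrite /D XE YE.
  have -> : n1 * E * (a * y1 + b * y2) ^+ 2 = E * (n1 * a * a * y1 ^+ 2 +
    2 * (n1 * a * b) * y1 * y2 + n1 * b * b * y2 ^+ 2) by ring.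
  have -> : n2 * F * (c * y1 + d * y2) ^+ 2 = F * (n2 * c * c * y1 ^+ 2 +
    2 * (n2 * d * c) * y1 * y2 + n2 * d * d * y2 ^+ 2) by ring.
  by rewrite q1 q2 q3 q4 q5 q6; ring.
rewrite AB.
have mm : m * (a * d * - (b * c)) = (a * c) ^+ 2.
  have -> : m * (a * d * - (b * c)) = a * d * (- (m * b)) * c by ring.
  rewrite -n2c (_ : _ * c = n2 * d * (a * c * c)); last by ring.
  by rewrite n2d; ring.
have -> : m * (a * d * - (b * c) * (F - E) ^+ 2) = (a * c) ^+ 2 * (F - E) ^+ 2.
  by rewrite -mm; ring.
ring.
Qed.

(** This convexity bound holds whatever the sign of [k], and so covers at once
the case where the second mode has a stable direction. *)
Lemma expR_chord (R : realType) (k s eta : R) : 0 < eta -> 0 <= s <= eta ->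
  expR (k * s) <= 1 - s / eta + s / eta * expR (k * eta).
Proof.
move=> eta0 /andP[s0 se].
have r01 : 0 <= s / eta <= 1.
  by rewrite divr_ge0 ?(ltW eta0) //= ler_pdivrMr // mul1r.
have := @convex_expR R (Itv01 (andP r01).1 (andP r01).2) (k * eta) 0.
rewrite !convRE /= expR0 mulr1 mulr0 addr0 /unstable.onem.
have -> : s / eta * (k * eta) = k * s by field; rewrite gt_eqF.
lra.
Qed.

(** This is [<x, K x>] for [K = diag(1/X, 1/Y)] and the scalar product
[m x1 y1 + x2 y2]. *)
Definition weighted_form (R : realFieldType) (m X Y x1 x2 : R) : R :=
  m * x1 ^+ 2 / X + x2 ^+ 2 / Y.

Lemma weighted_form_ge0 (R : realFieldType) (m X Y x1 x2 : R) :
  0 <= m -> 0 <= X -> 0 <= Y -> 0 <= weighted_form m X Y x1 x2.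
Proof.
move=> m0 X0 Y0; apply: addr_ge0; apply: divr_ge0 => //.
  exact: mulr_ge0 m0 (sqr_ge0 _).
exact: sqr_ge0.
Qed.

Lemma weighted_form_decay (R : realType) (m X Y p q h u1 u2 : R) :
  0 < m -> 0 < X -> 0 < Y -> p <= q -> 0 <= h ->
  weighted_form m X Y (expR (- p * h) * u1) (expR (- q * h) * u2)
  <= expR (- p * h) ^+ 2 * weighted_form m X Y u1 u2.
Proof.
move=> m0 X0 Y0 pq h0; rewrite /weighted_form mulrDr; apply: lerD.
  by rewrite le_eqVlt; apply/orP; left; apply/eqP; ring.
rewrite exprMn -mulrA ler_wpM2r //; first by rewrite divr_ge0 ?sqr_ge0 // ltW.
rewrite lerXn2r ?nnegrE ?expR_ge0 // ler_expR ler_wpM2r //.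
by rewrite lerN2.
Qed.

(** Here [S = M^-1 diag(e, f) M] is self-adjoint and nonnegative for
[m x1 y1 + x2 y2], and [W] is the form [<x, K x>].  The bounds on [e] and [f]
give [<S K x, K x> <= rho W x] for every [x].  For [u = S K v], Cauchy-Schwarz
for [S] yields [(W u)^2 = <S K v, K u>^2 <= rho W v * rho W u]. *)
Lemma symmetric_contraction (R : realFieldType)
    (a b c d m n1 n2 E F X Y e f r v1 v2 w1 w2 : R) :
  a * d - b * c = 1 -> symmetrizing a b c d m n1 n2 ->
  (forall y1 y2,
     n1 * E * (a * y1 + b * y2) ^+ 2 + n2 * F * (c * y1 + d * y2) ^+ 2
     <= m * X * y1 ^+ 2 + Y * y2 ^+ 2) ->
  0 < X <= Y -> 0 <= r <= 1 ->
  0 <= e <= 1 - r + r * E -> 0 <= f <= 1 - r + r * F ->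
  w1 = a * (v1 / X) + b * (v2 / Y) -> w2 = c * (v1 / X) + d * (v2 / Y) ->
  weighted_form m X Y (d * (e * w1) - b * (f * w2)) (a * (f * w2) - c * (e * w1))
  <= ((1 - r) / X + r) ^+ 2 * weighted_form m X Y v1 v2.
Proof.
move=> det1 [m0 n10 n20 [n1a n2c n1b n2d]] SK /andP[X0 XY] /andP[r0 r1].
move=> /andP[e0 eE] /andP[f0 fF] w1E w2E; set W := weighted_form m X Y.
have Y0 : 0 < Y by exact: lt_le_trans XY.
set u1 := d * _ - _; set u2 := a * _ - _; set rho := _ / X + r.
have rho0 : 0 < rho.
  have Xi : 0 < X^-1 by rewrite invr_gt0.
  rewrite /rho; move: r0; rewrite le_eqVlt => /predU1P[<-|r0].
    by rewrite subr0 mul1r addr0.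
  by rewrite ltr_wpDl // divr_ge0 ?subr_ge0 // ltW.
pose q z1 z2 := n1 * e * z1 ^+ 2 + n2 * f * z2 ^+ 2.
have qW x1 x2 : q (a * (x1 / X) + b * (x2 / Y)) (c * (x1 / X) + d * (x2 / Y))
    <= rho * W x1 x2.
  have Sy := SK (x1 / X) (x2 / Y).
  set z1 := a * _ + _ in Sy *; set z2 := c * _ + _ in Sy *.
  have qle : q z1 z2 <= (1 - r) * (n1 * z1 ^+ 2 + n2 * z2 ^+ 2) +
      r * (n1 * E * z1 ^+ 2 + n2 * F * z2 ^+ 2).
    have h1 : n1 * z1 ^+ 2 * e <= n1 * z1 ^+ 2 * (1 - r + r * E).
      by rewrite ler_wpM2l // mulr_ge0 ?sqr_ge0 // ltW.
    have h2 : n2 * z2 ^+ 2 * f <= n2 * z2 ^+ 2 * (1 - r + r * F).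
      by rewrite ler_wpM2l // mulr_ge0 ?sqr_ge0 // ltW.
    by rewrite /q; lra.
  apply: (le_trans qle); rewrite /rho (mulrDl _ _ (W _ _)) lerD //.
    rewrite -mulrA ler_wpM2l ?subr_ge0 //.
    have -> : n1 * z1 ^+ 2 + n2 * z2 ^+ 2 = m * (x1 / X) ^+ 2 + (x2 / Y) ^+ 2.
      have -> : n1 * z1 ^+ 2 + n2 * z2 ^+ 2 =
        (n1 * a * a + n2 * c * c) * (x1 / X) ^+ 2 +
        2 * (n1 * b * a + n2 * d * c) * (x1 / X) * (x2 / Y) +
        (n1 * b * b + n2 * d * d) * (x2 / Y) ^+ 2 by rewrite /z1 /z2; ring.
      rewrite n1a n2c n1b n2d.
      have -> : m * d * a + - (m * b) * c = m * (a * d - b * c) by ring.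
      have -> : - c * b + a * d = a * d - b * c by ring.
      by rewrite det1; ring.
    rewrite /W /weighted_form mulrDr; apply: lerD.
      by rewrite le_eqVlt; apply/orP; left; apply/eqP; field; rewrite gt_eqF.
    have -> : (x2 / Y) ^+ 2 = Y^-1 * (x2 ^+ 2 / Y) by field; rewrite gt_eqF.
    by rewrite ler_wpM2r ?lef_pV2 // divr_ge0 ?sqr_ge0 // ltW.
  rewrite ler_wpM2l // (le_trans Sy) // le_eqVlt; apply/orP; left; apply/eqP.
  by rewrite /W /weighted_form; field; rewrite !gt_eqF.
pose z1 := a * (u1 / X) + b * (u2 / Y); pose z2 := c * (u1 / X) + d * (u2 / Y).
have WE : W u1 u2 = n1 * e * w1 * z1 + n2 * f * w2 * z2.
  have -> : n1 * e * w1 * z1 + n2 * f * w2 * z2 =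
    e * w1 * (n1 * a * (u1 / X) + n1 * b * (u2 / Y)) +
    f * w2 * (n2 * c * (u1 / X) + n2 * d * (u2 / Y)) by rewrite /z1 /z2; ring.
  rewrite n1a n2c n1b n2d.
  by rewrite /W /weighted_form /u1 /u2; ring.
(* Cauchy-Schwarz for q, from the positivity of q at rho w - z. *)
have Wv := qW v1 v2; have Wu := qW u1 u2.
rewrite -w1E -w2E in Wv; rewrite -/z1 -/z2 in Wu.
have pos : 0 <= q (rho * w1 - z1) (rho * w2 - z2).
  by rewrite addr_ge0 // mulr_ge0 ?sqr_ge0 // mulr_ge0 // ltW.
have qE : q (rho * w1 - z1) (rho * w2 - z2) =
  rho ^+ 2 * q w1 w2 + q z1 z2 - 2 * rho * W u1 u2 by rewrite WE /q; ring.
rewrite qE in pos.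
have h : rho ^+ 2 * q w1 w2 <= rho ^+ 2 * (rho * W v1 v2).
  by rewrite ler_wpM2l // sqr_ge0.
rewrite -(ler_pM2l rho0).
have -> : rho * (rho ^+ 2 * W v1 v2) = rho ^+ 2 * (rho * W v1 v2) by ring.
lra.
Qed.

(** The first factor comes from the time [s] spent in the second mode, the
second one from the time in excess of [tau] spent in the first mode. *)
Definition period_rate (R : realType) (p X tau eta t s : R) : R :=
  ((1 - s / eta) / X + s / eta) ^+ 2 * expR (- p * (t - tau)) ^+ 2.

Lemma period_rate_le (R : realType) (p X tau eta t s : R) :
  0 < p -> 1 < X -> 0 < eta -> tau <= t -> 0 <= s <= eta ->
  [/\ period_rate p X tau eta t s <= (1 - s / eta) / X + s / eta,
      (1 - s / eta) / X + s / eta <= 1,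
      period_rate p X tau eta t s <= expR (- p * (t - tau)) &
      expR (- p * (t - tau)) <= 1].
Proof.
move=> p0 X1 eta0 tt /andP[s0 se]; rewrite /period_rate.
have r0 : 0 <= s / eta by rewrite divr_ge0 // ltW.
have r1 : s / eta <= 1 by rewrite ler_pdivrMr // mul1r.
have X0 : 0 < X by exact: lt_trans X1.
have Xi0 : 0 < X^-1 by rewrite invr_gt0.
have Xi1 : X^-1 <= 1 by rewrite invf_le1 // ltW.
have e1 : expR (- p * (t - tau)) <= 1.
  by rewrite -expR0 ler_expR mulNr oppr_le0 mulr_ge0 ?(ltW p0) // subr_ge0.
have e0 := expR_ge0 (- p * (t - tau)).
set e := expR _ in e0 e1 *; set r := s / eta in r0 r1 *.
have rho0 : 0 <= (1 - r) / X + r by nra.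
have rho1 : (1 - r) / X + r <= 1 by nra.
set rho := _ + r in rho0 rho1 *.
have e2 : e ^+ 2 <= e by rewrite expr2 ler_piMl.
have rho2 : rho ^+ 2 <= rho by rewrite expr2 ler_piMl.
split => //.
  by apply: le_trans rho2; rewrite ler_piMr ?sqr_ge0 // (le_trans e2).
by apply: le_trans e2; rewrite ler_piMl ?sqr_ge0 // (le_trans rho2).
Qed.

(** Each of the two factors of the rate is at most 1, hence tends to 1 as soon
as their product does; the durations are continuous functions of them. *)
Lemma period_rate_cvg1 (R : realType) (p X tau eta : R) (t s : nat -> R) :
  0 < p -> 1 < X -> 0 < eta -> (forall k, tau <= t k) ->
  (forall k, 0 <= s k <= eta) ->
  (period_rate p X tau eta (t k) (s k)) @[k --> \oo] --> (1 : R) ->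
  (t k, s k) @[k --> \oo] --> (tau, eta).
Proof.
move=> p0 X1 eta0 tt ss c1.
have X0 : 0 < X by exact: lt_trans X1.
have le k := period_rate_le p0 X1 eta0 (tt k) (ss k).
have cr : ((1 - s k / eta) / X + s k / eta) @[k --> \oo] --> (1 : R).
  apply: (squeeze_cvgr _ c1 (@cvg_cst _ _ _ _ _)).
  by near=> k; case: (le k) => -> ->.
have ce : expR (- p * (t k - tau)) @[k --> \oo] --> (1 : R).
  apply: (squeeze_cvgr _ c1 (@cvg_cst _ _ _ _ _)).
  by near=> k; case: (le k) => _ _ -> ->.
have ct : t @ \oo --> tau.
  have -> : t = (fun k => tau - ln (expR (- p * (t k - tau))) / p).
    by apply/funext => k; rewrite expRK; field; rewrite gt_eqF.
  rewrite -[X in _ --> X]subr0 -(mul0r p^-1).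
  apply: cvgB; first exact: cvg_cst.
  apply: cvgM; last exact: cvg_cst.
  rewrite -(@ln1 R); apply: continuous_cvg => //.
  exact: continuous_ln.
have X10 : X - 1 != 0 by rewrite subr_eq0 gt_eqF.
have cs : s @ \oo --> eta.
  have -> : s = (fun k => eta *
      (1 - (1 - ((1 - s k / eta) / X + s k / eta)) * (X / (X - 1)))).
    by apply/funext => k; field; rewrite !gt_eqF ?subr_gt0.
  rewrite -[X in _ --> X](mulr1 eta) -[X in eta * X]subr0.
  rewrite -(mul0r (X / (X - 1))) -{1}(subrr 1).
  apply: cvgM; first exact: cvg_cst.
  apply: cvgB; first exact: cvg_cst.
  apply: cvgM; last exact: cvg_cst.
  by apply: cvgB; first exact: cvg_cst.
exact: cvg_pair ct cs.
Unshelve. all: by end_near. Qed.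

(** The time [t - tau] in excess is put first: it maps [(u1, u2)] to [(v1, v2)]
with the exponential decay of the first mode, and the remaining [tau] units of
time produce the matrix [K] of [symmetric_contraction]. *)
Lemma switched_contraction (R : realType)
    (p1 q1 p2 q2 a b c d m n1 n2 tau eta t s u1 u2 w1 w2 : R) :
  a * d - b * c = 1 -> 0 < a * d < 1 -> symmetrizing a b c d m n1 n2 ->
  0 < p1 -> p1 < q1 -> p2 < q2 -> 0 < tau -> 0 < eta -> q2 * eta < q1 * tau ->
  det_gap (a * d) (expR (p2 * eta)) (expR (q2 * eta))
    (expR (p1 * tau)) (expR (q1 * tau)) = 0 ->
  tau <= t -> 0 <= s <= eta ->
  w1 = a * (expR (- p1 * t) * u1) + b * (expR (- q1 * t) * u2) ->
  w2 = c * (expR (- p1 * t) * u1) + d * (expR (- q1 * t) * u2) ->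
  weighted_form m (expR (p1 * tau)) (expR (q1 * tau))
    (d * (expR (p2 * s) * w1) - b * (expR (q2 * s) * w2))
    (a * (expR (q2 * s) * w2) - c * (expR (p2 * s) * w1))
  <= period_rate p1 (expR (p1 * tau)) tau eta t s *
     weighted_form m (expR (p1 * tau)) (expR (q1 * tau)) u1 u2.
Proof.
move=> det1 ad01 sym p10 pq1 pq2 tau0 eta0 q2q1 gap0.
move=> tt /andP[s0 se] w1E w2E.
pose v1 := expR (- p1 * (t - tau)) * u1.
pose v2 := expR (- q1 * (t - tau)) * u2.
have vE k u : expR (- k * t) * u =
    expR (- k * (t - tau)) * u / expR (k * tau).
  by rewrite mulrAC -expRN -expRD; congr (expR _ * u); ring.
have v1E : expR (- p1 * t) * u1 = v1 / expR (p1 * tau) := vE p1 u1.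
have v2E : expR (- q1 * t) * u2 = v2 / expR (q1 * tau) := vE q1 u2.
rewrite v1E v2E in w1E w2E.
have sE := expR_chord _ eta0 (introT andP (conj s0 se)).
have EF : expR (p2 * eta) < expR (q2 * eta) by rewrite ltr_expR ltr_pM2r.
have FY : expR (q2 * eta) < expR (q1 * tau) by rewrite ltr_expR.
have SK y1 y2 := det_gap0_form_le y1 y2 det1 ad01 sym EF FY gap0.
apply: le_trans (symmetric_contraction (r := s / eta) det1 sym SK
  _ _ _ _ w1E w2E) _.
- by rewrite expR_gt0 ler_expR ler_pM2r // ltW.
- by rewrite divr_ge0 ?(ltW eta0) //= ler_pdivrMr // mul1r.
- by rewrite expR_ge0 sE.
- by rewrite expR_ge0 sE.
have [m0 _ _ _] := sym; rewrite /period_rate -[leRHS]mulrA ler_wpM2l ?sqr_ge0 //.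
apply: weighted_form_decay; rewrite ?expR_gt0 ?subr_ge0 //; exact: ltW.
Qed.

(** Stability is expressed with the Euclidean norm of [x], decay with the form
in the eigencoordinates of the first mode: both are positive definite. *)
Lemma weighted_form_enorm_equiv (R : realType) (P : 'M[R]_2)
    (X Y m : R) :
  P \in unitmx -> 0 < m -> 0 < X -> 0 < Y ->
  exists C C' : R, [/\ 0 < C, 0 < C',
    forall v, enorm v ^+ 2 <=
      C * weighted_form m X Y ((invmx P *m v) 0 0) ((invmx P *m v) 1 0) &
    forall v, weighted_form m X Y ((invmx P *m v) 0 0) ((invmx P *m v) 1 0) <=
      C' * enorm v ^+ 2].
Proof.
move=> uP m0 X0 Y0.
have [K K0 hK] := enorm_mulmx_le P.
have [K' K'0 hK'] := enorm_mulmx_le (invmx P).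
exists (K * (X / m + Y)), ((m / X + Y^-1) * K').
have p1 : 0 < X / m + Y by rewrite addr_gt0 ?divr_gt0.
have p2 : 0 < m / X + Y^-1 by rewrite addr_gt0 ?divr_gt0 ?invr_gt0.
split=> [||v|v]; [exact: mulr_gt0|exact: mulr_gt0| |].
  have vE : P *m (invmx P *m v) = v by rewrite mulmxA mulmxV // mul1mx.
  rewrite -{1}vE; apply: le_trans (hK _) _.
  rewrite -mulrA ler_pM2l // enorm_sqr; move: (invmx P *m v) => u.
  rewrite /weighted_form -subr_ge0.
  move: (u 0 0) (u 1 0) => u1 u2.
  have -> : (X / m + Y) * (m * u1 ^+ 2 / X + u2 ^+ 2 / Y) -
      (u1 ^+ 2 + u2 ^+ 2) = (Y * m / X) * u1 ^+ 2 + (X / m / Y) * u2 ^+ 2.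
    by field; rewrite !gt_eqF.
  apply: addr_ge0; rewrite mulr_ge0 ?sqr_ge0 // ltW //.
    by rewrite divr_gt0 ?mulr_gt0.
  by rewrite !divr_gt0.
have hv : (m / X + Y^-1) * enorm (invmx P *m v) ^+ 2 <=
    (m / X + Y^-1) * (K' * enorm v ^+ 2) by rewrite ler_pM2l.
rewrite -mulrA; apply: le_trans hv.
rewrite enorm_sqr /weighted_form -subr_ge0; move: (invmx P *m v) => u.
move: (u 0 0) (u 1 0) => u1 u2.
have -> : (m / X + Y^-1) * (u1 ^+ 2 + u2 ^+ 2) -
    (m * u1 ^+ 2 / X + u2 ^+ 2 / Y) = Y^-1 * u1 ^+ 2 + m / X * u2 ^+ 2.
  by field; rewrite !gt_eqF.
by apply: addr_ge0; rewrite mulr_ge0 ?sqr_ge0 // ltW // ?divr_gt0 ?invr_gt0.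
Qed.

(** The second bound at the end of the period is the decay from one period to
the next; inside the period both bounds show that [V] does not exceed its
initial value. *)
Lemma period_estimate (R : realType) (p1 q1 p2 q2 : R)
    (A1 A2 P1 P2 : 'M[R]_2) (a b c d m n1 n2 tau eta : R) (s : signal R) x k :
  P1 \in unitmx -> P2 \in unitmx ->
  A1 = P1 *m diag2 (- p1) (- q1) *m invmx P1 ->
  A2 = P2 *m diag2 p2 q2 *m invmx P2 ->
  invmx P2 *m P1 = mx2 a b c d ->
  a * d - b * c = 1 -> 0 < a * d < 1 -> symmetrizing a b c d m n1 n2 ->
  0 < p1 -> p1 < q1 -> p2 < q2 -> 0 < tau -> 0 < eta -> q2 * eta < q1 * tau ->
  det_gap (a * d) (expR (p2 * eta)) (expR (q2 * eta))
    (expR (p1 * tau)) (expR (q1 * tau)) = 0 ->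
  s 0 = Mode1 -> tau <= dwell1 s k -> dwell2 s k <= eta ->
  is_solution A1 A2 s x ->
  let V t := weighted_form m (expR (p1 * tau)) (expR (q1 * tau))
    ((invmx P1 *m x t) 0 0) ((invmx P1 *m x t) 1 0) in
  (forall t, sig_time s k.*2 <= t <= sig_time s k.*2.+1 ->
    V t <= V (sig_time s k.*2)) /\
  (forall t, sig_time s k.*2.+1 <= t <= sig_time s k.*2.+2 ->
    V t <= period_rate p1 (expR (p1 * tau)) tau eta (dwell1 s k)
             (t - sig_time s k.*2.+1) * V (sig_time s k.*2)).
Proof.
move=> uP1 uP2 A1E A2E ME det1 ad01 sym p10 pq1 pq2 tau0 eta0
  q2q1 gap0 s0 t1 t2 sx V.
have [m0 _ _ _] := sym.
set X := expR (p1 * tau) in V *; set Y := expR (q1 * tau) in V *.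
have X0 : 0 < X by exact: expR_gt0.
have Y0 : 0 < Y by exact: expR_gt0.
set d0 := sig_time s k.*2 in t1 *; set d1 := sig_time s k.*2.+1 in t1 t2 *.
set d2 := sig_time s k.*2.+2 in t1 t2 *.
have d01 : d0 < d1 by exact: sig_time_lt.
have [c1 D1] := solution_within k.*2 sx.
have [c2 D2] := solution_within k.*2.+1 sx.
rewrite (sig_mode _ s0) odd_double /= A1E in D1.
rewrite (sig_mode _ s0) /= odd_double /= A2E in D2.
have sol1 := mode_sol uP1 c1 D1; have sol2 := mode_sol uP2 c2 D2.
rewrite -/d0 -/d1 -/d2 in sol1 sol2.
split=> t tt.
  rewrite /V; have [-> ->] := sol1 t tt; have h0 : 0 <= t - d0.
    by case/andP: tt; rewrite subr_ge0.
  apply: le_trans (weighted_form_decay _ _ m0 X0 Y0 (ltW pq1) h0) _.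
  apply: ler_piMl; first by apply: weighted_form_ge0; exact: ltW.
  rewrite exprn_ile1 ?expR_ge0 // -expR0 ler_expR mulNr oppr_le0.
  by rewrite mulr_ge0 // ltW.
have [w1E w2E] := sol2 t tt.
have [|u1E u2E] := sol1 d1; first by rewrite lexx ltW.
pose u s := invmx P1 *m x s; pose w s := invmx P2 *m x s.
(* The relation w = M u and its inverse, which has this form as det M = 1. *)
have wu r : (w r 0 0 = a * u r 0 0 + b * u r 1 0) *
            (w r 1 0 = c * u r 0 0 + d * u r 1 0).
  have -> : w r = mx2 a b c d *m u r.
    by rewrite -ME /u /w mulmxA mulmxK // mulmxA.
  by rewrite !mulmxE2 !mxE.
have uw r : (u r 0 0 = d * w r 0 0 - b * w r 1 0) *
            (u r 1 0 = a * w r 1 0 - c * w r 0 0).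
  rewrite !wu; split.
    rewrite -[LHS]mul1r -det1; ring.
  rewrite -[LHS]mul1r -det1; ring.
rewrite /V -/(u t) -/(u d0) (uw t).1 (uw t).2 /w w1E w2E.
apply: (switched_contraction det1 ad01 sym) => //.
- case/andP: tt => t1t tt2; rewrite subr_ge0 t1t /=.
  by rewrite (le_trans _ t2) // lerB.
- by rewrite -/(w d1) wu /u u1E u2E.
- by rewrite -/(w d1) wu /u u1E u2E.
Qed.

(** * A Lyapunov criterion for switched systems *)

(** The values decrease to a limit; a positive one would force the factors,
which dominate the successive ratios, to tend to 1. *)
Lemma cvg0_of_factors (R : realType) (V f : nat -> R) :
  (forall k, 0 <= V k) -> (forall k, V k.+1 <= f k * V k) ->
  (forall k, f k <= 1) -> ~ (f @ \oo --> (1 : R)) -> V @ \oo --> (0 : R).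
Proof.
move=> V0 Vf f1 nf.
have Vdec : {homo V : n m / (n <= m)%N >-> m <= n}.
  apply/nonincreasing_seqP => k; apply: le_trans (Vf k) _.
  by rewrite ler_piMl.
have cV : cvgn V.
  by apply: nonincreasing_is_cvgn => //; exists 0 => _ [k _ <-].
have LV := nonincreasing_cvgn_ge Vdec cV.
have L0 : 0 <= limn V by apply: limr_ge => //; exact: nearW.
(* If the limit were positive, the ratios V k.+1 / V k would tend to 1 and
   squeeze f between themselves and 1. *)
move: L0; rewrite le_eqVlt => /predU1P[L0|L0]; first by rewrite L0.
case: nf; have Vpos k : 0 < V k by exact: lt_le_trans (LV k).
apply: (@squeeze_cvgr _ _ _ _ (fun k => V k.+1 / V k) (fun=> 1)).
- by near=> k; rewrite f1 andbT ler_pdivrMr.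
- rewrite -(@divff _ (limn V)) ?gt_eqF //.
  apply: cvgM; first by rewrite (cvg_shiftS V).
  by apply: cvgV => //; rewrite gt_eqF.
- exact: cvg_cst.
Unshelve. all: by end_near. Qed.

Section lyapunov.

(** A form of Lyapunov's criterion adapted to switching: [V] is allowed to grow
inside a period, as long as it does not exceed its value at the beginning. *)
Context {R : realType} (A1 A2 : 'M[R]_2) (s : signal R) (V : 'cV[R]_2 -> R).
Context (C C' : R) (enorm_le : forall v, enorm v ^+ 2 <= C * V v).
Context (le_enorm : forall v, V v <= C' * enorm v ^+ 2).
Context (C0 : 0 < C) (C'0 : 0 < C').
Context (V_period : forall x, is_solution A1 A2 s x -> forall k t,
  sig_time s k.*2 <= t <= sig_time s k.*2.+2 ->
  V (x t) <= V (x (sig_time s k.*2))).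

Lemma lyapunov_ge0 v : 0 <= V v.
Proof. by rewrite -(pmulr_rge0 _ C0) (le_trans _ (enorm_le v)) ?sqr_ge0. Qed.

Lemma lyapunov_nonincreasing x : is_solution A1 A2 s x ->
  {homo (fun k => V (x (sig_time s k.*2))) : i j / (i <= j)%N >-> j <= i}.
Proof.
move=> sx; apply/nonincreasing_seqP => k; rewrite doubleS.
apply: (@V_period x sx k (sig_time s k.*2.+2)).
by rewrite lexx andbT sig_time_mono ltnW.
Qed.

Lemma lyapunov_le x k t : is_solution A1 A2 s x ->
  sig_time s k.*2 <= t -> V (x t) <= V (x (sig_time s k.*2)).
Proof.
move=> sx kt; have [j jt] := sig_period s (le_trans (sig_time_ge0 s _) kt).
have [kj|jk] := leqP k j.
  exact: le_trans (V_period sx jt) (lyapunov_nonincreasing sx kj).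
apply: (@V_period x sx k t); rewrite kt /=; case/andP: jt => _ /le_trans -> //.
by rewrite sig_time_mono !ltnS leq_double ltnW.
Qed.

(** The values at the beginnings of the periods decrease and dominate those
inside the periods, so that [V (x t)] never exceeds [V (x 0)]. *)
Lemma lyapunov_stable : stable A1 A2 s.
Proof.
move=> e e0; have K0 : 0 < C * C' by exact: mulr_gt0.
have sK0 : 0 < Num.sqrt (C * C') by rewrite sqrtr_gt0.
exists (e / Num.sqrt (C * C')); first exact: divr_gt0.
move=> x sx; rewrite ltr_pdivlMr // => xe t t0.
rewrite -(@ltr_pXn2r _ 2) ?nnegrE ?enorm_ge0 ?ltW //.
apply: le_lt_trans (enorm_le _) _.
have Vt : V (x t) <= C' * enorm (x 0) ^+ 2.
  have := @lyapunov_le x 0 t sx; rewrite double0 sig_time0 => /(_ (ltW t0)) h.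
  exact: le_trans h (le_enorm _).
apply: (@le_lt_trans _ _ ((enorm (x 0) * Num.sqrt (C * C')) ^+ 2)).
  rewrite exprMn (sqr_sqrtr (ltW K0)).
  by rewrite [leRHS]mulrC -[leRHS]mulrA ler_pM2l.
by rewrite ltr_pXn2r ?nnegrE ?mulr_ge0 ?enorm_ge0 ?ltW.
Qed.

Lemma lyapunov_asymptotically_stable (f : nat -> R) :
  (forall x, is_solution A1 A2 s x -> forall k,
     V (x (sig_time s k.*2.+2)) <= f k * V (x (sig_time s k.*2))) ->
  (forall k, f k <= 1) -> ~ (f @ \oo --> (1 : R)) ->
  asymptotically_stable A1 A2 s.
Proof.
move=> Vf f1 nf; split; first exact: lyapunov_stable.
move=> x sx; pose v k := V (x (sig_time s k.*2)).
have v0 : v @ \oo --> (0 : R).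
  apply: (@cvg0_of_factors _ v f) => //; first by move=> k; exact: lyapunov_ge0.
  by move=> k; rewrite /v doubleS; exact: Vf.
apply/cvgrPdist_lt => e e0.
have /cvgrPdist_lt/(_ (e ^+ 2 / C)) := v0.
rewrite divr_gt0 ?exprn_gt0 // => /(_ isT)[N _ /(_ N (leqnn N))].
rewrite sub0r normrN ger0_norm ?lyapunov_ge0 // ltr_pdivlMr // => vN.
near=> t; rewrite sub0r normrN ger0_norm ?enorm_ge0 //.
rewrite -(@ltr_pXn2r _ 2) ?nnegrE ?enorm_ge0 ?(ltW e0) //.
apply: le_lt_trans (enorm_le _) _; apply: le_lt_trans vN.
rewrite mulrC ler_pM2r //; apply: lyapunov_le => //.
Unshelve. all: by end_near. Qed.

End lyapunov.

(** * Stability for the threshold dwell time *)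

Theorem theorem4p4 (R : realType) (p1 q1 p2 q2 : R)
    (A1 A2 P1 P2 : 'M[R]_2) (a b c d eta : R)
    (hp1 : 0 < p1) (hq1 : p1 < q1)
    (h2 : (0 < p2 /\ p2 < q2) \/ (p2 <= 0 /\ 0 < q2))
    (hP1 : P1 \in unitmx) (hP2 : P2 \in unitmx)
    (hA1 : A1 = P1 *m diag2 (- p1) (- q1) *m invmx P1)
    (hA2 : A2 = P2 *m diag2 p2 q2 *m invmx P2)
    (hM : invmx P2 *m P1 = mx2 a b c d)
    (hdet : \det (mx2 a b c d) = 1)
    (ha : a != 0) (hb : b != 0) (hc : c != 0) (hd : d != 0)
    (hsgn : a * b * c * d / `|a * b * c * d| = - 1)
    (heta : 0 < eta) :
  exists tau : R,
    unique (fun t : R =>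
      Num.max (p2 / p1) (q2 / q1) * eta < t /\
      - ((expR (q2 * eta - p1 * t) - 1) * (expR (p2 * eta - q1 * t) - 1)
         / ((expR (- p1 * t) - expR (- q1 * t))
            * (expR (q2 * eta) - expR (p2 * eta)))) = a * d) tau /\
    (forall s : signal R, signals tau eta s -> stable A1 A2 s) /\
    (forall s : signal R, signals' tau eta s -> asymptotically_stable A1 A2 s).
Proof.
have [q20 pq2] : 0 < q2 /\ p2 < q2.
  case: h2 => -[]; first by move=> /lt_trans h /[dup]/h.
  by move=> /le_lt_trans h /[dup]/h.
have q10 : 0 < q1 by exact: lt_trans hq1.
rewrite det_mx2 in hdet.
have neg : a * b * c * d < 0.
  by apply: lt0_of_div_normr hsgn; rewrite !mulf_neq0.
have [ad01 [m [n1 [n2 sym]]]] := symmetrizer hdet neg.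
have [m0 _ _ _] := sym.
have [tau tauP] := threshold_exists_unique hp1 hq1 pq2 q20 ad01 heta.
exists tau; split => //; have [[tau_gt tau_eq] _] := tauP.
have q2q1 : q2 * eta < q1 * tau.
  rewrite -ltr_pdivrMl // mulrA [_ * q2]mulrC; apply: le_lt_trans tau_gt.
  by rewrite ler_pM2r // le_max lexx orbT.
have tau0 : 0 < tau by rewrite -(pmulr_rgt0 _ q10) (lt_trans _ q2q1) // mulr_gt0.
have gap0 := (threshold_eqE (a * d) hq1 pq2 heta tau0).1 tau_eq.
set X := expR (p1 * tau); set Y := expR (q1 * tau).
have X1 : 1 < X by rewrite -(@expR0 R) ltr_expR mulr_gt0.
have X0 : 0 < X := expR_gt0 _; have Y0 : 0 < Y := expR_gt0 _.
pose V (v : 'cV[R]_2) :=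
  weighted_form m X Y ((invmx P1 *m v) 0 0) ((invmx P1 *m v) 1 0).
have [C [C' [C0 C'0 VC VC']]] := weighted_form_enorm_equiv hP1 m0 X0 Y0.
have period s x k t : signals tau eta s -> is_solution A1 A2 s x ->
    sig_time s k.*2 <= t <= sig_time s k.*2.+2 ->
    V (x t) <= V (x (sig_time s k.*2)).
  move=> [s0 /(_ k)[tk sk]] sx /andP[kt tk2].
  have [est1 est2] := period_estimate hP1 hP2 hA1 hA2 hM hdet ad01 sym
    hp1 hq1 pq2 tau0 heta q2q1 gap0 s0 tk sk sx.
  have [tk1|/ltW tk1] := leP t (sig_time s k.*2.+1).
    by apply: est1; rewrite kt.
  apply: le_trans (est2 t _) _; first by rewrite tk1.
  apply: ler_piMl; first by apply: weighted_form_ge0; exact: ltW.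
  have [|r1 r2 _ _] :=
    period_rate_le (s := t - sig_time s k.*2.+1) hp1 X1 heta tk.
    by rewrite subr_ge0 tk1 (le_trans _ sk) // lerB.
  exact: le_trans r1 r2.
have st s : signals tau eta s -> stable A1 A2 s.
  move=> hs; apply: (lyapunov_stable VC VC' C0 C'0) => x sx k t.
  exact: period.
split=> // s [hs ns].
have [s0 dw] := hs.
have dw2 k : 0 <= dwell2 s k <= eta by rewrite ltW ?dwell2_gt0 ?(dw k).2.
apply: (lyapunov_asymptotically_stable VC VC' C0 C'0 _
  (f := fun k => period_rate p1 X tau eta (dwell1 s k) (dwell2 s k))).
- by move=> x sx k t; exact: period.
- move=> x sx k.
  have [_ est2] := period_estimate hP1 hP2 hA1 hA2 hM hdet ad01 sym
    hp1 hq1 pq2 tau0 heta q2q1 gap0 s0 (dw k).1 (dw k).2 sx.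
  by apply: est2; rewrite lexx ltW // sig_time_lt.
- move=> k; have [r1 r2 _ _] := period_rate_le hp1 X1 heta (dw k).1 (dw2 k).
  exact: le_trans r1 r2.
- move=> c1; apply: ns; apply: (period_rate_cvg1 hp1 X1 heta _ dw2 c1) => k.
  exact: (dw k).1.
Qed.
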